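(* Let $r \geq 3$. There is $n_0 = n_0(r)$ such that for all $n \geq n_0$ and every non-empty subset $X \subseteq [2,n]$ the following hold. (a) If $X=\{2\}$ then $\mathcal{AHM}_3$ is optimal for $X$. (b) If $|X|=2$ and $X \cap \{2,3\}\neq \emptyset$ then $\mathcal{AHM}_3$ is optimal for $X$. Furthermore, if also $4 \in X$, then $\mathcal{AHM}_4$ is simultaneously optimal for $X$. (c) If $|X|=3$ and $\{2,3\} \subseteq X$ then $\mathcal{AHM}_3$ is optimal for $X$. Furthermore, if also $X=\{2,3,4\}$, then $\mathcal{AHM}_4$ is simultaneously optimal for $X$. (d) If $X \subseteq [2,r+1]$ and $X$ is not as in (a)--(c), then $\mathcal{AHM}_m$ is optimal for $X$, where $m := \max X$. No other MLCIFs are optimal for $X$ as in (a)--(d), and for every other non-empty $X \subseteq [2,n]$ the star $\mathcal{S}$ is the unique optimal MLCIF for $X$.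
   Context: For integers $a\le b$, $[b]=\{1,\dots,b\}$ and $[a,b]=\{a,\dots,b\}$ (empty if $a>b$); $\binom{Y}{r}$ is the family of $r$-element subsets of $Y$. A family $\mathcal{A}\subseteq\binom{[n]}{r}$ is intersecting if no two members are disjoint. For $A=\{a_1<\dots<a_r\}$, $B=\{b_1<\dots<b_r\}$ write $B\le A$ if $b_i\le a_i$ for all $i$; $\mathcal{A}$ is left-compressed if $A\in\mathcal{A}$ and $B\le A$ imply $B\in\mathcal{A}$. An MLCIF is a left-compressed intersecting family in $\binom{[n]}{r}$ that is maximal (under inclusion) among left-compressed intersecting families in $\binom{[n]}{r}$. For $X\subseteq[n]$, $\mathrm{hit}_X(\mathcal{A})=|\{A\in\mathcal{A}: A\cap X\neq\emptyset\}|$. An MLCIF $\mathcal{A}$ is optimal for $X$ if $\mathrm{hit}_X(\mathcal{A})\ge \mathrm{hit}_X(\mathcal{F})$ for every MLCIF $\mathcal{F}\subseteq\binom{[n]}{r}$. The star is $\mathcal{S}=\{A\in\binom{[n]}{r}:1\in A\}$. For $t\in[n]$, the $t$-adjusted Hilton–Milner family is $\mathcal{AHM}_t=\{A\in\mathcal{S}: A\cap[2,t]\ne\emptyset\}\cup\{A\in\binom{[n]}{r}:[2,t]\subseteq A\}$. *)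

(* Defs.v *)
From HB Require Import structures.
From mathcomp Require Import all_boot all_order.

Set Implicit Arguments.
Unset Strict Implicit.
Unset Printing Implicit Defensive.

(* The ground set [n] = {1, ..., n} lives in 'I_n.+1, so that an element has
   its own value; the extra point 0 is excluded by [uniform], the family of
   r-element subsets of [n]. *)

Definition itv (n a b : nat) : {set 'I_n.+1} := [set i : 'I_n.+1 | a <= i <= b].

Definition uniform (n r : nat) : {set {set 'I_n.+1}} :=
  [set A : {set 'I_n.+1} | (A \subset itv n 1 n) && (#|A| == r)].

Definition intersecting (n : nat) (F : {set {set 'I_n.+1}}) : Prop :=
  forall A B, A \in F -> B \in F -> ~~ [disjoint A & B].

Definition elems (n : nat) (A : {set 'I_n.+1}) : seq nat :=
  [seq val i | i <- enum A].

Lemma elems_sorted (n : nat) (A : {set 'I_n.+1}) : sorted ltn (elems A).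
Proof.
rewrite /elems {1}/enum_mem -enumT.
apply: (subseq_sorted ltn_trans _ (iota_ltn_sorted 0 n.+1)).
by rewrite -val_enum_ord; apply: map_subseq; apply: filter_subseq.
Qed.

(* [all2] also requires both lists to have the same length. *)
Definition set_le (n : nat) (B A : {set 'I_n.+1}) : bool :=
  all2 leq (elems B) (elems A).

Definition left_compressed (n r : nat) (F : {set {set 'I_n.+1}}) : Prop :=
  forall A B, A \in F -> B \in uniform n r -> set_le B A -> B \in F.

Definition LCIF (n r : nat) (F : {set {set 'I_n.+1}}) : Prop :=
  [/\ F \subset uniform n r, left_compressed r F & intersecting F].

Definition MLCIF (n r : nat) (F : {set {set 'I_n.+1}}) : Prop :=
  LCIF r F /\ (forall G, LCIF r G -> F \subset G -> G = F).

Definition hit (n : nat) (X : {set 'I_n.+1}) (F : {set {set 'I_n.+1}}) : nat :=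
  #|[set A in F | A :&: X != set0]|.

Definition optimal (n r : nat) (X : {set 'I_n.+1}) (F : {set {set 'I_n.+1}}) :
    Prop :=
  MLCIF r F /\ (forall G, MLCIF r G -> hit X G <= hit X F).

Definition star (n r : nat) : {set {set 'I_n.+1}} :=
  [set A in uniform n r | inord 1 \in A].

Definition AHM (n r t : nat) : {set {set 'I_n.+1}} :=
  [set A in star n r | A :&: itv n 2 t != set0]
  :|: [set A in uniform n r | itv n 2 t \subset A].

(* [inord k] is the element k of [n] as soon as k <= n. *)
Definition case_a (n : nat) (X : {set 'I_n.+1}) : Prop := X = [set inord 2].

Definition case_b (n : nat) (X : {set 'I_n.+1}) : Prop :=
  #|X| = 2 /\ X :&: [set inord 2; inord 3] != set0.

Definition case_c (n : nat) (X : {set 'I_n.+1}) : Prop :=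
  #|X| = 3 /\ [set inord 2; inord 3] \subset X.

Definition case_d (n r : nat) (X : {set 'I_n.+1}) : Prop :=
  [/\ X \subset itv n 2 r.+1, ~ case_a X, ~ case_b X & ~ case_c X].

(* Main.v *)
Require Import Defs.
From mathcomp Require Import all_boot all_order.
From mathcomp Require Import zify.

(** Write [D] for the binomial coefficient (n-2 choose r-2).  A maximal
    left-compressed intersecting family [F] is determined by the traces of its
    members on the window [[1, 2r]], because two members with disjoint traces
    could be compressed to complementary halves of the window.  If [F] is not
    the star then it contains [[2, r+1]], so every trace has at least two
    elements, and up to [O(D / n)] the family is counted by its traces of size
    two.  Either one of these avoids [1], which forces [F = AHM_3], or they are
    the pairs [{1, j}] for [2 <= j <= t].  To first order [X] is hit by [D] sets
    for each such pair that meets [X]; the star reaches [|X| D], and for [F] to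
    match it the pair [{1, max X}] must occur, in which case the members hitting
    [X] all lie in [AHM_m] with [m = max X].  So only the star, [AHM_3] and
    [AHM_m] can be optimal.  These are compared exactly: [AHM_t] arises from the
    star by trading the sets that miss [[2, t]] for the sets that contain
    [[2, t]] but not [1]. *)

Set Implicit Arguments.
Unset Strict Implicit.
Unset Printing Implicit Defensive.

Lemma disjoint_setUl (T : finType) (A B C : {set T}) :
  [disjoint A :|: B & C] = [disjoint A & C] && [disjoint B & C].
Proof. by rewrite -!setI_eq0 setIUl setU_eq0. Qed.

Lemma disjoint_setUr (T : finType) (A B C : {set T}) :
  [disjoint A & B :|: C] = [disjoint A & B] && [disjoint A & C].
Proof. by rewrite -!setI_eq0 setIUr setU_eq0. Qed.

Lemma disjoint_set0 (T : finType) (A : {set T}) : [disjoint A & set0].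
Proof. by rewrite -setI_eq0 setI0. Qed.

Lemma setI_neq0 (T : finType) (A B : {set T}) x :
  x \in A -> x \in B -> A :&: B != set0.
Proof. by move=> xA xB; apply/set0Pn; exists x; rewrite inE xA. Qed.

Lemma exists_subset_card (T : finType) (S V : {set T}) k :
  S \subset V -> #|S| <= k <= #|V| ->
  exists2 W : {set T}, S \subset W & W \subset V /\ #|W| = k.
Proof.
move=> sSV /andP[Sk kV].
have : 0 < #|[set A : {set T} | A \subset V :\: S & #|A| == k - #|S|]|.
  by rewrite cards_draws bin_gt0 cardsD (setIidPr sSV) leq_sub2r.
case/card_gt0P => A; rewrite inE subsetD => /andP[/andP[sAV dAS] /eqP cA].
exists (S :|: A); first exact: subsetUl.
split; first by rewrite subUset sSV.
by rewrite cardsU setIC disjoint_setI0 // cards0 cA subn0 subnKC.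
Qed.

Lemma leq_card_bigcup (T I : finType) (J : {set I}) (F : I -> {set T}) c :
  (forall i, i \in J -> #|F i| <= c) -> #|\bigcup_(i in J) F i| <= #|J| * c.
Proof.
move=> Fc; rewrite -sum_nat_const.
apply: (@leq_trans (\sum_(i in J) #|F i|)); last exact: leq_sum.
elim/big_rec2: _ => [|i m S _ IH]; first by rewrite cards0.
by rewrite (leq_trans (leq_card_setU _ _)) // leq_add2l.
Qed.

Lemma all2_leq_countP (s t : seq nat) :
  sorted ltn s -> sorted ltn t -> size s = size t ->
  reflect (forall k, count (leq^~ k) t <= count (leq^~ k) s) (all2 leq s t).
Proof.
move=> s_lt t_lt est; apply: (iffP idP) => [|le_count].
  elim: s t {s_lt t_lt est} => [|x s IHs] [|y t] //= /andP[xy /IHs st] k.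
  by apply: leq_add => //; case: (leqP y k) => // /(leq_trans xy) ->.
rewrite all2E est eqxx; apply/(all_nthP (0, 0)) => i.
rewrite size_zip est minnn => i_lt; rewrite nth_zip //=.
apply: (@Order.POrderTheory.nth_count_le _ nat).
  by rewrite Order.NatOrder.leEnat (sub_sorted _ s_lt) // => ? ?; apply: ltnW.
apply: leq_trans (le_count (nth 0 t i)).
by rewrite (@Order.POrderTheory.count_le_nth _ nat) ?Order.NatOrder.ltEnat.
Qed.

Lemma cardsU_setD (T : finType) (A B : {set T}) :
  #|A :|: B| = #|A| + #|B :\: A|.
Proof.
by rewrite cardsU cardsD [B :&: A]setIC addnBA // subset_leq_card ?subsetIr.
Qed.

Lemma binS_sub n k a b : a < n -> b < k ->
  'C(n - a, k - b) = 'C(n - a.+1, k - b) + 'C(n - a.+1, k - b.+1).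
Proof. by move=> an bk; rewrite -(subnSK an) -(subnSK bk) binS. Qed.

Lemma leq_bin_sub m k i : 0 < k ->
  'C(m, k) <= 'C(m - i, k) + i * 'C(m.-1, k.-1).
Proof.
case: k => // k _; elim: i => [|i IHi]; first by rewrite subn0 addn0.
apply: leq_trans IHi _; rewrite mulSn addnA leq_add2r subnS.
have [->|mi_gt0] := posnP (m - i); first by rewrite leq_addr.
rewrite -{1}(prednK mi_gt0) binS leq_add2l leq_bin2l //.
by rewrite -!subn1 leq_sub2r ?leq_subr.
Qed.

Lemma bin_bonferroni m k i : 0 < k ->
  i * 'C(m, k) + 'C(m.+1 - i, k.+1) <=
  'C(m.+1, k.+1) + i * i * 'C(m.-1, k.-1).
Proof.
move=> k0; elim: i => [|i IHi]; first by rewrite subn0 addn0.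
have drop := leq_bin_sub m i k0; have [im|mi] := leqP i m.
  have := binS (m - i) k; rewrite -subSn // subSS in IHi *.
  by move: drop IHi; lia.
rewrite subSS; move: drop IHi.
have [-> ->] : m - i = 0 /\ m.+1 - i = 0 by lia.
by rewrite !bin0n; case: k k0 => //= k _; nia.
Qed.

Lemma bin_pred_dominated c m k : 0 < k -> c.+1 * k <= m ->
  c * 'C(m.-1, k.-1) < 'C(m, k).
Proof.
case: k => // k _ cm; have := mul_bin_diag m k.
have : 0 < 'C(m.-1, k) by rewrite bin_gt0; lia.
by move: 'C(_, _) 'C(_, _) => E D E0 eD /=; nia.
Qed.

Definition gain n r t : nat := 'C(n - t, r.+1 - t).

Lemma gain_gt0 n r t : r < n -> 0 < gain n r t.
Proof. by move=> rn; rewrite bin_gt0 leq_sub2r. Qed.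

Lemma gain_lt n r s t : r.+1 < n -> s < t <= r.+1 -> gain n r t < gain n r s.
Proof.
move=> rn /andP[]; elim: t => // t IHt; rewrite ltnS leq_eqVlt => st tr.
have lt_t : gain n r t.+1 < gain n r t.
  rewrite /gain (binS_sub _ tr); last by lia.
  by rewrite -[X in X < _]add0n ltn_add2r bin_gt0; lia.
case/orP: st => [/eqP->//|st]; apply: ltn_trans lt_t (IHt st _); exact: ltnW.
Qed.

Lemma gain_leq n r s t : r.+1 < n -> s <= r.+1 -> t <= r.+1 ->
  (gain n r s <= gain n r t) = (t <= s).
Proof.
move=> rn sr tr; apply: (@leq_nmono_in _ [pred k | k <= r.+1]) => //=.
by move=> i j ir jr ij; apply: gain_lt; rewrite ?ij.
Qed.

(** * Intervals, uniform sets and compression *)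

Lemma eq_inord n k (i : 'I_n.+1) : k <= n -> (i == inord k) = (i == k :> nat).
Proof. by move=> kn; rewrite -val_eqE /= inordK. Qed.

Lemma itvS n a b c d : c <= a -> b <= d -> itv n a b \subset itv n c d.
Proof. by move=> ca bd; apply/subsetP => i; rewrite !inE; lia. Qed.

Lemma itv_empty n a b : b < a -> itv n a b = set0.
Proof. by move=> ba; apply/setP => i; rewrite !inE; lia. Qed.

Lemma itv_recl n a b :
  a <= n -> a <= b -> itv n a b = inord a |: itv n a.+1 b.
Proof. by move=> an ab; apply/setP => i; rewrite !inE eq_inord //; lia. Qed.

Lemma inord_itv n a b k : k <= n -> (inord k \in itv n a b) = (a <= k <= b).
Proof. by move=> kn; rewrite inE inordK. Qed.

Lemma card_itv n a b : b <= n -> #|itv n a b| = b.+1 - a.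
Proof.
move=> bn; have [d] := ubnP (b.+1 - a); elim: d a => // d IHd a ad.
have [ba|ab] := ltnP b a; first by rewrite itv_empty // cards0; lia.
rewrite itv_recl ?(leq_trans ab) // cardsU1 inord_itv ?(leq_trans ab) //.
by rewrite ltnn /= IHd; lia.
Qed.

Lemma itv23 n : 3 <= n -> itv n 2 3 = [set inord 2; inord 3].
Proof.
move=> n_gt2; rewrite itv_recl ?(ltnW n_gt2) // itv_recl //.
by rewrite (itv_empty n (ltnSn 3)) setU0.
Qed.

Section Families.

Variables n r : nat.
Implicit Types (A B T W X Z : {set 'I_n.+1}) (F G : {set {set 'I_n.+1}}).

Lemma uniformP A :
  reflect (A \subset itv n 1 n /\ #|A| = r) (A \in uniform n r).
Proof. by rewrite inE; apply: (iffP andP) => -[-> /eqP]. Qed.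

Lemma subset_ground (i : 'I_n.+1) : 1 <= i -> [set i] \subset itv n 1 n.
Proof. by move=> i1; rewrite sub1set inE i1 -ltnS ltn_ord. Qed.

Lemma inord1_notin X : 1 <= n -> X \subset itv n 2 n -> inord 1 \notin X.
Proof. by move=> n_gt0 /subsetP sX; apply/negP => /sX; rewrite inord_itv. Qed.

Lemma sub_itv2_bigmax X :
  X \subset itv n 2 n -> X \subset itv n 2 (\max_(i in X) i).
Proof.
move=> /subsetP sX; apply/subsetP => x xX; have := sX x xX.
by rewrite !inE => /andP[-> _]; apply: leq_bigmax_cond.
Qed.

Lemma bigmax_leq_itv2 X k : X \subset itv n 2 n ->
  (\max_(i in X) i <= k) = (X \subset itv n 2 k).
Proof.
move=> sX; apply/idP/subsetP => [mk|sXk].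
  by apply/subsetP; apply: subset_trans (sub_itv2_bigmax sX) _; rewrite itvS.
by apply/bigmax_leqP => i /sXk; rewrite inE => /andP[].
Qed.

Lemma bigmax_lt3 X : 2 <= n -> X != set0 -> X \subset itv n 2 n ->
  \max_(i in X) i < 3 -> X = [set inord 2].
Proof.
move=> n_gt1 X0 sX m3; have sX2 : X \subset [set inord 2].
  apply/subsetP => i /(subsetP (sub_itv2_bigmax sX)).
  by rewrite !inE eq_inord //; lia.
by apply/eqP; move: sX2; rewrite subset1 (negPf X0) orbF.
Qed.

Definition card_upto A k : nat := #|A :&: itv n 1 k|.

Lemma card_upto0 A : card_upto A 0 = 0.
Proof. by rewrite /card_upto itv_empty // setI0 cards0. Qed.

Lemma leq_card_upto A k l : k <= l -> card_upto A k <= card_upto A l.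
Proof. by move=> kl; rewrite subset_leq_card ?setIS ?itvS. Qed.

Lemma card_upto_leq_card A k : card_upto A k <= #|A|.
Proof. by rewrite subset_leq_card ?subsetIl. Qed.

Lemma card_upto_succ A k : card_upto A k.+1 <= (card_upto A k).+1.
Proof.
have [nk|kn] := leqP n k.
  rewrite leqW // subset_leq_card // setIS //; apply/subsetP => i.
  by rewrite !inE; have := ltn_ord i; lia.
apply: (@leq_trans #|inord k.+1 |: A :&: itv n 1 k|); last first.
  by rewrite cardsU1; apply: (leq_add (leq_b1 _) (leqnn _)).
apply/subset_leq_card/subsetP => i; rewrite !inE eq_inord //.
by move=> /andP[->]; lia.
Qed.

Lemma card_upto_cons A k : 1 <= n -> 1 <= k ->
  card_upto A k = (inord 1 \in A) + #|A :&: itv n 2 k|.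
Proof.
move=> n_gt0 k_gt0; rewrite /card_upto itv_recl // (cardsD1 (inord 1)).
rewrite !inE eqxx andbT; congr (_ + _); apply: eq_card => i.
rewrite !inE eq_inord //.
by case: (i \in A); rewrite ?andbF //; lia.
Qed.

Lemma card_upto_count A k : A \subset itv n 1 n ->
  card_upto A k = count (leq^~ k) (elems A).
Proof.
move=> /subsetP sA.
rewrite /card_upto /elems count_map cardE /enum_mem !size_filter count_filter.
apply: eq_count => i; rewrite /= !inE; have [/sA|_] := boolP (i \in A).
  by rewrite inE andbT => /andP[->].
by rewrite andbF.
Qed.

Lemma set_leP A B : A \in uniform n r -> B \in uniform n r ->
  reflect (forall k, card_upto A k <= card_upto B k) (set_le B A).
Proof.
move=> /uniformP[sA cA] /uniformP[sB cB].
apply: (iffP (all2_leq_countP _ _ _)); rewrite ?elems_sorted //.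
- by rewrite !size_map -!cardE cA.
- by move=> le_AB k; rewrite !card_upto_count.
- by move=> le_AB k; rewrite -!card_upto_count.
Qed.

Lemma LCIF_closed F A B : LCIF r F -> A \in F -> B \in uniform n r ->
  (forall k, card_upto A k <= card_upto B k) -> B \in F.
Proof.
move=> [/subsetP sF lF _] FA uB le_AB; apply: lF (FA) (uB) _.
by apply/set_leP => //; apply: sF.
Qed.

Lemma LCIF_uniform F A : LCIF r F -> A \in F -> A \in uniform n r.
Proof. by case=> /subsetP sF _ _; apply: sF. Qed.

Lemma LCIF_meet F A B : LCIF r F -> A \in F -> B \in F -> ~~ [disjoint A & B].
Proof. by case=> _ _; apply. Qed.

(** * Uniform sets with prescribed and forbidden elements *)

Definition with_without T Z : {set {set 'I_n.+1}} :=
  [set A in uniform n r | (T \subset A) && [disjoint A & Z]].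

Lemma in_with_without T Z A : (A \in with_without T Z) =
  [&& A \in uniform n r, T \subset A & [disjoint A & Z]].
Proof. by rewrite in_set. Qed.

Lemma card_with_without T Z :
  T \subset itv n 1 n -> Z \subset itv n 1 n -> [disjoint T & Z] ->
  #|T| <= r -> #|with_without T Z| = 'C(n - #|T| - #|Z|, r - #|T|).
Proof.
move=> sT sZ dTZ cT; set U := itv n 1 n :\: T :\: Z.
have cU : #|U| = n - #|T| - #|Z|.
  rewrite /U setDDl cardsD (setIidPr _) ?subUset ?sT // cardsU.
  by rewrite disjoint_setI0 // cards0 card_itv // subn1 subn0 subnDA.
rewrite -cU -cards_draws.
rewrite -[RHS](@card_in_imset _ _ (fun S => S :|: T)); last first.
  move=> A B; rewrite !inE !subsetD => /andP[/andP[/andP[_ dA] _] _].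
  move=> /andP[/andP[/andP[_ dB] _] _] /(congr1 (fun S => S :\: T)).
  by rewrite !setDUl !setDv !setU0 !(setDidPl _).
apply: eq_card => A; rewrite in_with_without; apply/idP/imsetP.
  move=> /and3P[/uniformP[sA cA] sTA dAZ]; exists (A :\: T).
    rewrite inE cardsD (setIidPr sTA) cA eqxx andbT.
    by rewrite subsetD setSD //= (disjointWl (subsetDl _ _) dAZ).
  by rewrite setUC setDE setUIr setUCr setIT; apply/esym/setUidPr.
case=> S; rewrite inE !subsetD => /andP[/andP[/andP[sS dST] dSZ] /eqP cS] ->.
rewrite subsetUr disjoint_setUl dSZ dTZ !andbT; apply/uniformP.
by rewrite subUset sS sT cardsU disjoint_setI0 // cards0 cS subn0 subnK.
Qed.

Lemma with_without_neq0 T Z :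
  T \subset itv n 1 n -> Z \subset itv n 1 n -> [disjoint T & Z] ->
  #|T| <= r -> #|Z| + r <= n -> with_without T Z != set0.
Proof.
move=> sT sZ dTZ cT cZ.
by rewrite -card_gt0 card_with_without // bin_gt0 leq_subRL ?leq_subLR; lia.
Qed.

Lemma leq_card_meet k W : k <= r -> W \subset itv n 1 n ->
  #|[set A in uniform n r | k <= #|A :&: W|]| <= 'C(#|W|, k) * 'C(n - k, r - k).
Proof.
move=> kr sW; rewrite -cards_draws; set P := [set T : {set 'I_n.+1} | _ & _].
apply: (@leq_trans #|\bigcup_(T in P) with_without T set0|); last first.
  apply: leq_card_bigcup => T; rewrite inE => /andP[sT /eqP cT].
  rewrite card_with_without ?cT ?cards0 ?subn0 ?sub0set ?(subset_trans sT) //.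
  exact: disjoint_set0.
apply/subset_leq_card/subsetP => A; rewrite in_set => /andP[uA cA].
have [||T _ [sT cT]] := @exists_subset_card _ set0 (A :&: W) k.
- exact: sub0set.
- by rewrite cards0.
move: sT; rewrite subsetI => /andP[sTA sTW].
apply/bigcupP; exists T; first by rewrite inE sTW cT eqxx.
by rewrite in_with_without uA sTA disjoint_set0.
Qed.

Lemma card_with_pair (y : 'I_n.+1) : 2 <= r -> 1 <= n -> 2 <= y ->
  #|with_without [set inord 1; y] set0| = 'C(n - 2, r - 2).
Proof.
move=> r_gt1 n_gt0 y2; have c2 : #|[set inord 1; y]| = 2.
  by rewrite cards2 eq_sym eq_inord // neq_ltn y2 orbT.
rewrite card_with_without ?c2 ?cards0 ?subn0 ?sub0set //.
  by rewrite subUset !subset_ground ?inordK // ltnW.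
exact: disjoint_set0.
Qed.

Lemma card_with1 Z : 1 <= r -> 1 <= n -> Z \subset itv n 2 n ->
  #|with_without [set inord 1] Z| = 'C(n - 1 - #|Z|, r - 1).
Proof.
move=> r_gt0 n_gt0 sZ; rewrite card_with_without ?cards1 //.
- by rewrite subset_ground ?inordK.
- by rewrite (subset_trans sZ) ?itvS.
- by rewrite disjoints1 inord1_notin.
Qed.

Lemma card_with_itv2 t : 1 <= t <= r.+1 -> r < n ->
  #|with_without (itv n 2 t) [set inord 1]| = gain n r t.
Proof.
move=> tr rn; have ct : #|itv n 2 t| = t.-1 by rewrite card_itv; lia.
rewrite card_with_without ?ct ?cards1.
- by congr 'C(_, _); lia.
- by rewrite itvS //; lia.
- by rewrite subset_ground ?inordK //; lia.
- by rewrite disjoint_sym disjoints1 inord_itv //; lia.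
- by lia.
Qed.

(** * The star and the adjusted Hilton-Milner families *)

Lemma in_star A :
  (A \in star n r) = (A \in uniform n r) && (inord 1 \in A).
Proof. by rewrite in_set. Qed.

Definition hitting X F : {set {set 'I_n.+1}} := [set A in F | A :&: X != set0].

Lemma in_hitting X F A : (A \in hitting X F) = (A \in F) && (A :&: X != set0).
Proof. by rewrite in_set. Qed.

Lemma in_AHM t A :
  (A \in AHM n r t) =
  (A \in uniform n r) &&
    ((inord 1 \in A) && (A :&: itv n 2 t != set0) || (itv n 2 t \subset A)).
Proof. by rewrite in_setU !in_set -andbA -andb_orr. Qed.

Lemma mem1_card_upto A : 1 <= n -> (inord 1 \in A) = (0 < card_upto A 1).
Proof.
move=> n_gt0; rewrite card_upto_cons // itv_empty // setI0 cards0 addn0.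
by case: (_ \in A).
Qed.

Lemma meets_itv2_card_upto A t : 1 <= n -> 1 <= t -> inord 1 \in A ->
  (A :&: itv n 2 t != set0) = (1 < card_upto A t).
Proof. by move=> n_gt0 t1 A1; rewrite card_upto_cons // A1 ltnS card_gt0. Qed.

Lemma itv2_subset_card_upto A t : 1 <= t <= n -> inord 1 \notin A ->
  (itv n 2 t \subset A) = (t.-1 <= card_upto A t).
Proof.
move=> /andP[t1 tn] /negPf A1; rewrite card_upto_cons ?A1 //; last by lia.
have <- : #|itv n 2 t| = t.-1 by rewrite card_itv //; lia.
apply/idP/idP => [/setIidPr->//|ct]; apply/setIidPr/eqP.
by rewrite eqEcard subsetIr.
Qed.

Lemma in_AHM_card_upto t A : 3 <= t <= n ->
  (A \in AHM n r t) =
  (A \in uniform n r) &&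
    (if inord 1 \in A then 1 < card_upto A t else t.-1 <= card_upto A t).
Proof.
move=> t3; rewrite in_AHM; case: (A \in uniform n r) => //=.
case: ifPn => A1 /=; last by rewrite itv2_subset_card_upto //; lia.
rewrite -meets_itv2_card_upto //; try lia.
apply/orP/idP => [[//|sA]|]; last by left.
by apply/set0Pn; exists (inord 2); rewrite inE (subsetP sA) inord_itv; lia.
Qed.

Lemma star_LCIF : 1 <= n -> LCIF r (star n r).
Proof.
move=> n_gt0; split.
- by apply/subsetP => A; rewrite in_star => /andP[].
- move=> A B; rewrite !in_star => /andP[uA A1] uB /(set_leP uA uB)/(_ 1).
  by move: A1; rewrite uB !mem1_card_upto //; apply: leq_trans.
- move=> A B; rewrite !in_star => /andP[_ A1] /andP[_ B1].
  by apply/pred0Pn; exists (inord 1); rewrite /= A1.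
Qed.

Lemma AHM_intersecting t : 2 <= t <= n -> intersecting (AHM n r t).
Proof.
move=> t2 A B; have i2 : inord 2 \in itv n 2 t by rewrite inord_itv; lia.
rewrite !in_AHM => /andP[_ hA] /andP[_ hB]; apply/pred0Pn.
case/orP: hA hB => [/andP[A1 /set0Pn[i]]|/subsetP sA].
  rewrite inE => /andP[iA it] /orP[/andP[B1 _]|/subsetP sB].
    by exists (inord 1); rewrite /= A1.
  by exists i; rewrite /= iA sB.
case/orP => [/andP[_ /set0Pn[i]]|/subsetP sB].
  by rewrite inE => /andP[iB it]; exists i; rewrite /= iB sA.
by exists (inord 2); rewrite /= sA ?sB.
Qed.

Lemma AHM_LCIF t : 3 <= t <= n -> LCIF r (AHM n r t).
Proof.
move=> t3; split; last by apply: AHM_intersecting; lia.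
  by apply/subsetP => A; rewrite in_AHM => /andP[].
move=> A B; rewrite !in_AHM_card_upto // => /andP[uA hA] uB.
move=> /(set_leP uA uB) le_AB; rewrite uB /=.
have := le_AB 1; have := le_AB t; move: hA.
by rewrite !mem1_card_upto; try lia; do 2 (case: ifP => ?); lia.
Qed.

Lemma MLCIF_LCIF F : MLCIF r F -> LCIF r F.
Proof. by case. Qed.

Lemma MLCIF_sub_eq F G : MLCIF r F -> LCIF r G -> F \subset G -> F = G.
Proof. by move=> [_ maxF] LG sFG; apply/esym/maxF. Qed.

Lemma MLCIF_of_disjoint F : LCIF r F ->
  (forall A, A \in uniform n r -> A \notin F ->
     exists2 B, B \in F & [disjoint B & A]) ->
  MLCIF r F.
Proof.
move=> LF missed; split=> // G LG sFG; apply/eqP; rewrite eqEsubset sFG andbT.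
apply/subsetP => A GA; apply/negPn/negP => nFA.
have [B FB dBA] := missed A (LCIF_uniform LG GA) nFA.
by have := LCIF_meet LG (subsetP sFG _ FB) GA; rewrite dBA.
Qed.

Lemma exists_disjoint A T : 2 * r <= n -> A \in uniform n r ->
  T \subset itv n 1 n -> [disjoint T & A] -> #|T| <= r ->
  exists B, [/\ B \in uniform n r, T \subset B & [disjoint B & A]].
Proof.
move=> rn /uniformP[sA cA] sT dTA cT.
have /set0Pn[B] : with_without T A != set0.
  by rewrite with_without_neq0 // cA addnn -mul2n.
by rewrite in_with_without => /and3P[uB sTB dBA]; exists B.
Qed.

Lemma star_MLCIF : 1 <= r -> 2 * r <= n -> MLCIF r (star n r).
Proof.
move=> r_gt0 rn; have n_gt0 : 1 <= n by lia.
apply: MLCIF_of_disjoint => [|A uA]; first exact: star_LCIF.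
rewrite in_star uA => /= A1; have [|||B [uB sB dBA]] :=
  @exists_disjoint A [set inord 1] rn uA; rewrite ?cards1 ?disjoints1 //.
  by rewrite subset_ground ?inordK.
by exists B => //; rewrite in_star uB -sub1set.
Qed.

Lemma exists_disjoint_pair A (i : 'I_n.+1) : 2 <= r -> 2 * r <= n ->
  A \in uniform n r -> inord 1 \notin A -> 2 <= i -> i \notin A ->
  exists2 B, B \in star n r & i \in B /\ [disjoint B & A].
Proof.
move=> r_gt1 rn uA A1 i2 iA; have [|||B [uB]] :=
  @exists_disjoint A [set inord 1; i] rn uA.
- rewrite subUset !subset_ground ?inordK //; lia.
- by rewrite disjoint_setUl !disjoints1 A1.
- by rewrite cards2; case: (_ != _) => //; apply: ltnW.
rewrite subUset !sub1set => /andP[B1 iB] dBA.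
by exists B => //; rewrite in_star uB.
Qed.

Lemma AHM_MLCIF t : 3 <= t <= r.+1 -> 2 * r <= n -> MLCIF r (AHM n r t).
Proof.
move=> tr rn; apply: MLCIF_of_disjoint => [|A uA].
  by apply: AHM_LCIF; lia.
rewrite in_AHM uA negb_or negb_and negbK /= => /andP[].
have [A1 /= /eqP dA _|A1 _ /subsetPn[i it iA]] := boolP (inord 1 \in A).
  have [|||B [uB sB dBA]] := @exists_disjoint A (itv n 2 t) rn uA.
  - by rewrite itvS //; lia.
  - by rewrite -setI_eq0 setIC dA.
  - by rewrite card_itv; lia.
  by exists B => //; rewrite in_AHM uB sB orbT.
have i2 : 2 <= i by move: it; rewrite inE => /andP[].
have [|B] := exists_disjoint_pair _ rn uA A1 i2 iA; first by lia.
rewrite in_star => /andP[uB B1] [iB dBA]; exists B => //.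
by rewrite in_AHM uB B1 (setI_neq0 iB).
Qed.

End Families.

Arguments uniformP {n r A}.
Arguments MLCIF_sub_eq {n r F G}.

(** * The window [1, 2r] *)

Section Window.

Variables n r : nat.
Implicit Types (A B C D : {set 'I_n.+1}) (F G : {set {set 'I_n.+1}}).

Definition le_upto m B A : bool :=
  [forall k : 'I_m.+1, card_upto A k <= card_upto B k].

Lemma le_uptoP m B A :
  reflect (forall k, k <= m -> card_upto A k <= card_upto B k) (le_upto m B A).
Proof.
apply: (iffP forallP) => [le_AB k|le_AB k]; last by apply: le_AB; rewrite -ltnS.
by rewrite -ltnS => km; apply: (le_AB (Ordinal km)).
Qed.

Lemma le_upto_refl m A : le_upto m A A.
Proof. by apply/le_uptoP. Qed.

Lemma le_upto_trans m B A C : le_upto m B A -> le_upto m C B -> le_upto m C A.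
Proof.
move=> /le_uptoP AB /le_uptoP BC; apply/le_uptoP => k km.
exact: leq_trans (AB k km) (BC k km).
Qed.

Lemma LCIF_fill F m A B D : LCIF r F -> m <= n -> A \in F -> le_upto m B A ->
  B :&: itv n 1 m \subset D -> D \subset itv n 1 m -> #|D| = r -> D \in F.
Proof.
move=> LF mn FA /le_uptoP le_AB sBD sDm cD.
have uA := LCIF_uniform LF FA; have [_ cA] := uniformP uA.
apply: (LCIF_closed LF FA) => [|k].
  by apply/uniformP; rewrite (subset_trans sDm) ?itvS.
have [km|mk] := leqP k m.
  apply: leq_trans (le_AB k km) _.
  rewrite subset_leq_card // subsetI subsetIr andbT.
  by apply: subset_trans sBD; rewrite setIS ?itvS.
apply: leq_trans (card_upto_leq_card A k) _; rewrite cA -cD /card_upto.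
by rewrite (setIidPl _) // (subset_trans sDm) // itvS // ltnW.
Qed.

(* Disjoint traces on the window would extend to complementary halves of it,
   both of which are compressions of members of F. *)
Lemma LCIF_le_upto_meet F A B A' B' : LCIF r F -> 2 * r <= n ->
  A \in F -> B \in F -> A' \in uniform n r -> B' \in uniform n r ->
  le_upto (2 * r) A' A -> le_upto (2 * r) B' B -> ~~ [disjoint A' & B'].
Proof.
move=> LF rn FA FB /uniformP[_ cA'] /uniformP[_ cB'] le_A le_B.
apply/negP => dAB; set W := itv n 1 (2 * r).
have cW : #|W| = 2 * r by rewrite card_itv // subn1.
have cI C : #|C| = r -> #|C :&: W| <= r.
  by move=> <-; rewrite subset_leq_card ?subsetIl.
have [||D sAD [/subsetDP[DW dDB] cD]] :=
    @exists_subset_card _ (A' :&: W) (W :\: (B' :&: W)) r.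
- rewrite subsetD subsetIr /=.
  exact: disjointWl (subsetIl _ _) (disjointWr (subsetIl _ _) dAB).
- rewrite cI //= cardsD (setIidPr (subsetIr _ _)) cW.
  by have := cI _ cB'; clear; lia.
have FD : D \in F by apply: (LCIF_fill LF rn FA le_A).
have FD' : W :\: D \in F.
  apply: (LCIF_fill LF rn FB le_B); last 1 first.
  - by rewrite cardsD (setIidPr DW) cW cD mul2n -addnn addnK.
  - by rewrite subsetD subsetIr disjoint_sym.
  - exact: subsetDl.
have := LCIF_meet LF FD FD'.
by rewrite -setI_eq0 setIDA setIC setDIl setDv setI0 eqxx.
Qed.

Lemma MLCIF_le_upto F A B : MLCIF r F -> 2 * r <= n -> A \in F ->
  B \in uniform n r -> le_upto (2 * r) B A -> B \in F.
Proof.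
move=> MF rn FA uB le_AB; have LF := MLCIF_LCIF MF.
pose G := [set C in uniform n r | [exists D in F, le_upto (2 * r) C D]].
have inG C D : C \in uniform n r -> D \in F -> le_upto (2 * r) C D -> C \in G.
  by move=> uC FD le_DC; rewrite in_set uC; apply/exists_inP; exists D.
rewrite (MLCIF_sub_eq (G := G) MF); first exact: inG le_AB.
  split.
  - by apply/subsetP => C; rewrite in_set => /andP[].
  - move=> C D; rewrite in_set => /andP[uC /exists_inP[E FE le_EC]] uD.
    move=> /(set_leP uC uD) le_CD; apply: (inG _ E) => //.
    by apply: le_upto_trans le_EC _; apply/le_uptoP.
  - move=> C D; rewrite in_set => /andP[uC /exists_inP[C' FC' le_C]].
    rewrite in_set => /andP[uD /exists_inP[D' FD' le_D]].
    exact: LCIF_le_upto_meet FC' FD' uC uD le_C le_D.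
apply/subsetP => C FC; apply: (inG _ C) => //; last exact: le_upto_refl.
exact: LCIF_uniform FC.
Qed.

End Window.

(** * Members of a maximal family other than the star *)

Section FullUpto.

Variables n r : nat.
Implicit Types (A B X : {set 'I_n.+1}) (F : {set {set 'I_n.+1}}).

Definition full_upto F j : bool := hitting (itv n 2 j) (star n r) \subset F.

Lemma full_upto_itv2 F B j : LCIF r F -> 2 <= r -> 2 * r <= n ->
  full_upto F j -> B \in F -> inord 1 \notin B -> itv n 2 j \subset B.
Proof.
move=> LF r_gt1 rn fj FB B1; apply/subsetP => i ij; apply/negPn/negP => iB.
have i2 : 2 <= i by move: ij; rewrite inE => /andP[].
have uB := LCIF_uniform LF FB.
have [A SA [iA dAB]] := exists_disjoint_pair r_gt1 rn uB B1 i2 iB.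
have FA : A \in F.
  by apply: (subsetP fj); rewrite in_hitting SA (setI_neq0 iA).
by have := LCIF_meet LF FA FB; rewrite dAB.
Qed.

Lemma full_upto_hitting_sub F X m : LCIF r F -> 2 <= r -> 2 * r <= n ->
  X \subset itv n 2 m -> full_upto F m ->
  hitting X F \subset hitting X (AHM n r m).
Proof.
move=> LF r_gt1 rn sX fm; apply/subsetP => A; rewrite !in_hitting.
move=> /andP[FA hA]; rewrite hA andbT in_AHM (LCIF_uniform LF FA) /=.
have [A1|A1] := boolP (inord 1 \in A); last by apply: full_upto_itv2 fm FA A1.
have [y /setIP[yA yX]] := set0Pn _ hA.
by rewrite (setI_neq0 yA) // (subsetP sX).
Qed.

Lemma full_upto_hit F X m : MLCIF r F -> 2 <= r -> 2 * r <= n ->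
  3 <= m <= r.+1 -> X != set0 -> X \subset itv n 2 m -> full_upto F m ->
  F = AHM n r m \/ hit X F < hit X (AHM n r m).
Proof.
move=> MF r_gt1 rn mr /set0Pn[x xX] sX fm; have LF := MLCIF_LCIF MF.
have sFA := full_upto_hitting_sub LF r_gt1 rn sX fm.
have [+ eq_card] := subset_leqif_cards sFA.
rewrite leq_eqVlt eq_card => /orP[/eqP eX|]; [left|by right].
apply/esym/(MLCIF_sub_eq (AHM_MLCIF mr rn) LF).
apply/subsetP => A HA; have := HA; rewrite in_setU => /orP[/(subsetP fm)//|].
rewrite in_set => /andP[_ sA].
have : A \in hitting X (AHM n r m).
  by rewrite in_hitting HA (setI_neq0 _ xX) // (subsetP sA) // (subsetP sX).
by rewrite -eX in_hitting => /andP[].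
Qed.

Section NonStar.

Hypotheses (r_gt2 : 3 <= r) (rn : 3 * r <= n).
Variable F : {set {set 'I_n.+1}}.
Hypotheses (MF : MLCIF r F) (nonstar : F <> star n r).

Let n_gt0 : 1 <= n. Proof. by lia. Qed.
Let r_gt1 : 2 <= r. Proof. by lia. Qed.
Let leq_2rn : 2 * r <= n. Proof. by lia. Qed.
Let LF : LCIF r F := MLCIF_LCIF MF.

Lemma nonstar_itv2 : itv n 2 r.+1 \in F.
Proof.
have /subsetPn[A FA nSA] : ~~ (F \subset star n r).
  apply/negP => sFS; apply: nonstar.
  exact: MLCIF_sub_eq (star_LCIF _ n_gt0) sFS.
have uA := LCIF_uniform LF FA; have [_ cA] := uniformP uA.
have /negPf A1 : inord 1 \notin A by move: nSA; rewrite in_star uA.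
have cI : #|itv n 2 r.+1| = r by rewrite card_itv; lia.
apply: (LCIF_closed LF FA); first by apply/uniformP; rewrite cI itvS //; lia.
case=> [|k]; first by rewrite !card_upto0.
rewrite !card_upto_cons // A1 inord_itv //= !add0n.
have [rk|kr] := leqP r k.
  rewrite (setIidPl (itvS _ _ _)) // cI -cA.
  by rewrite subset_leq_card ?subsetIl.
by rewrite (setIidPr (itvS n (leqnn 2) (leqW kr))) subset_leq_card ?subsetIr.
Qed.

Lemma nonstar_card_upto A : A \in F -> 1 < card_upto A (2 * r).
Proof.
move=> FA; rewrite ltnNge; apply/negP => cA.
have /set0Pn[B] : with_without r [set inord 1] (itv n 2 (2 * r)) != set0.
  rewrite with_without_neq0 ?subset_ground ?inordK ?itvS ?cards1 //; try lia.
    by rewrite disjoints1 inord_itv.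
  by rewrite card_itv //; lia.
rewrite in_with_without sub1set => /and3P[uB B1 dB].
have FB : B \in F.
  apply: (MLCIF_le_upto MF leq_2rn FA uB); apply/le_uptoP => -[|k] kr.
    by rewrite card_upto0.
  apply: leq_trans (leq_card_upto A kr) (leq_trans cA _).
  by rewrite card_upto_cons // B1.
have := LCIF_meet LF FB nonstar_itv2.
by rewrite (disjointWr _ dB) // itvS //; lia.
Qed.

Lemma nonstar_full_upto_leq j : j <= n -> full_upto F j -> j <= r.+1.
Proof.
move=> jn fj; have [j2|] := leqP 2 j; last by lia.
have notin1 : inord 1 \notin itv n 2 r.+1 by rewrite inord_itv.
have := full_upto_itv2 LF r_gt1 leq_2rn fj nonstar_itv2 notin1.
move=> /subsetP/(_ (inord j)).
by rewrite !inord_itv // j2 leqnn => /(_ isT).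
Qed.

Lemma pair_trace_full_upto A j : A \in F -> j \in A -> j <= 2 * r ->
  card_upto A (2 * r) <= 2 -> full_upto F j.
Proof.
move=> FA jA jr cA; have [sA _] := uniformP (LCIF_uniform LF FA).
have j_gt0 : 0 < j by move/(subsetP sA): jA; rewrite inE => /andP[].
apply/subsetP => B; rewrite in_hitting in_star => /andP[/andP[uB B1]].
rewrite meets_itv2_card_upto // => cB.
apply: (MLCIF_le_upto MF leq_2rn FA uB); apply/le_uptoP => k kr.
have [jk|kj] := leqP j k.
  exact: leq_trans (leq_card_upto A kr)
           (leq_trans cA (leq_trans cB (leq_card_upto B jk))).
case: k kr kj => [|k] kr kj; first by rewrite !card_upto0.
apply: (@leq_trans 1); last by rewrite card_upto_cons // B1.
rewrite -ltnS; apply: leq_trans cA; apply/proper_card/properP.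
split; first by rewrite setIS ?itvS.
by exists j; rewrite !inE jA j_gt0 // -ltnNge.
Qed.

Lemma pair_trace_AHM3 A : A \in F -> inord 1 \notin A ->
  card_upto A (2 * r) <= 2 -> F = AHM n r 3.
Proof.
move=> FA /negPf A1 cA; have t3 : 3 <= 3 <= n by lia.
apply/esym/(MLCIF_sub_eq _ LF); first by apply: AHM_MLCIF => //; lia.
apply/subsetP => B; rewrite in_AHM_card_upto // => /andP[uB hB].
have cB3 : 2 <= card_upto B 3 by case: ifP hB.
have cB2 : 1 <= card_upto B 2 by have := card_upto_succ B 2; lia.
have cA1 : card_upto A 1 = 0.
  by apply/eqP; rewrite -leqn0 leqNgt -mem1_card_upto ?A1.
apply: (MLCIF_le_upto MF leq_2rn FA uB); apply/le_uptoP => -[|[|[|k]]] kr.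
- by rewrite card_upto0.
- by rewrite cA1.
- by have := card_upto_succ A 1; rewrite cA1 => /leq_trans->.
- exact: leq_trans (leq_card_upto A kr)
           (leq_trans cA (leq_trans cB3 (leq_card_upto B _))).
Qed.

End NonStar.

End FullUpto.

(** * Counting the members that hit X *)

Section Hit.

Variables n r : nat.
Implicit Types (A T X Z : {set 'I_n.+1}) (F G : {set {set 'I_n.+1}}).

Lemma hitU X F G : [disjoint F & G] -> hit X (F :|: G) = hit X F + hit X G.
Proof.
move=> dFG; have -> : hit X (F :|: G) = #|hitting X F :|: hitting X G|.
  by apply: eq_card => A; rewrite !inE andb_orl.
apply/eqP; rewrite (leq_card_setU _ _).2.
by apply: disjointW dFG; apply/subsetP => A; rewrite inE => /andP[].
Qed.

Lemma hit_with_without X T Z :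
  hit X (with_without r T Z) + #|with_without r T (Z :|: X)| =
  #|with_without r T Z|.
Proof.
rewrite -[RHS](cardsID (hitting X setT)); congr (_ + _); apply: eq_card => A.
  by rewrite in_setI !in_hitting in_setT.
rewrite in_setD in_hitting !in_with_without in_setT negbK setI_eq0.
by rewrite disjoint_setUr [RHS]andbC !andbA.
Qed.

Lemma star_with_without : star n r = with_without r [set inord 1] set0.
Proof.
apply/setP => A; rewrite in_star in_with_without sub1set.
by rewrite disjoint_set0 andbT.
Qed.

Lemma hit_star X : 1 <= r -> 1 <= n -> X \subset itv n 2 n ->
  hit X (star n r) + 'C(n - 1 - #|X|, r - 1) = 'C(n - 1, r - 1).
Proof.
move=> r_gt0 n_gt0 sX; have := hit_with_without X [set inord 1] set0.
by rewrite set0U !card_with1 ?sub0set // cards0 subn0 -star_with_without.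
Qed.

Lemma star_split t : star n r =
  hitting (itv n 2 t) (star n r) :|: with_without r [set inord 1] (itv n 2 t).
Proof.
apply/setP => A; rewrite in_setU in_hitting in_with_without in_star sub1set.
rewrite -setI_eq0; case: (A \in uniform n r) => //=.
by case: (inord 1 \in A) => //=; case: eqP.
Qed.

Lemma AHM_split t : 2 <= t <= n -> AHM n r t =
  hitting (itv n 2 t) (star n r) :|: with_without r (itv n 2 t) [set inord 1].
Proof.
move=> t2; apply/setP => A; rewrite in_AHM in_setU in_hitting in_star.
rewrite in_with_without disjoint_sym disjoints1.
case: (A \in uniform n r) => //=.
have [sA|_] := boolP (itv n 2 t \subset A); last by rewrite /= !orbF.
have -> : A :&: itv n 2 t != set0.
  by rewrite (setIidPr sA) -card_gt0 card_itv; lia.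
by rewrite orbT andbT /= orbN.
Qed.

Lemma hit_AHM X t : 2 <= t <= n ->
  hit X (AHM n r t) + hit X (with_without r [set inord 1] (itv n 2 t)) =
  hit X (star n r) + hit X (with_without r (itv n 2 t) [set inord 1]).
Proof.
move=> t2; rewrite AHM_split // {2}(star_split t) !hitU.
- by rewrite addnAC.
- apply/pred0P => A /=; rewrite in_hitting in_with_without -setI_eq0.
  by case: eqP => _; rewrite ?andbF.
- apply/pred0P => A /=; rewrite in_hitting in_star in_with_without.
  by rewrite disjoint_sym disjoints1; case: (inord 1 \in A); rewrite ?andbF.
Qed.

Lemma hit_with1_itv2 X t : 1 <= r -> 1 <= t <= n -> X \subset itv n 2 n ->
  hit X (with_without r [set inord 1] (itv n 2 t)) +
    'C(n - t - #|X :\: itv n 2 t|, r - 1) = 'C(n - t, r - 1).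
Proof.
move=> r_gt0 tn sX.
have st : itv n 2 t \subset itv n 2 n by rewrite itvS //; lia.
have ct : #|itv n 2 t| = t.-1 by rewrite card_itv; lia.
have := hit_with_without X [set inord 1] (itv n 2 t).
rewrite !card_with1 ?subUset ?st // ?cardsU_setD ?ct; try lia.
by rewrite subnDA (_ : n - 1 - t.-1 = n - t) //; lia.
Qed.

Lemma hit_with_itv2 X t : 1 <= t <= r.+1 -> r < n -> X :&: itv n 2 t != set0 ->
  hit X (with_without r (itv n 2 t) [set inord 1]) = gain n r t.
Proof.
move=> tr rn /set0Pn[x /setIP[xX xt]].
rewrite -card_with_itv2 //; apply: eq_card => A.
rewrite in_hitting in_with_without.
have [sA|_] := boolP (itv n 2 t \subset A); last by rewrite /= !andbF.
by rewrite (setI_neq0 (subsetP sA x xt) xX) andbT.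
Qed.

Lemma hit_with_itv2_disjoint X t : 1 <= t <= r.+1 -> r < n ->
  X \subset itv n 2 n -> X :&: itv n 2 t = set0 ->
  hit X (with_without r (itv n 2 t) [set inord 1]) +
    'C(n - t - #|X|, r.+1 - t) = gain n r t.
Proof.
move=> tr rn sX Xt; have n_gt0 : 1 <= n by lia.
have := hit_with_without X (itv n 2 t) [set inord 1].
rewrite card_with_itv2 // => <-; congr (_ + _).
have ct : #|itv n 2 t| = t.-1 by rewrite card_itv; lia.
have cU : #|[set inord 1] :|: X| = #|X|.+1 by rewrite cardsU1 inord1_notin.
rewrite card_with_without ?ct ?cU.
- by congr 'C(_, _); lia.
- by rewrite itvS //; lia.
- by rewrite subUset subset_ground ?inordK // (subset_trans sX) ?itvS.
- rewrite disjoint_sym disjoint_setUl disjoints1 -[[disjoint X & _]]setI_eq0 Xt.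
  by rewrite inord_itv ?eqxx.
- by lia.
Qed.

Lemma hit_AHM_sub X t : 2 <= t <= r.+1 -> r < n -> X != set0 ->
  X \subset itv n 2 t -> hit X (AHM n r t) = hit X (star n r) + gain n r t.
Proof.
move=> tr rn X0 sX.
have sXn : X \subset itv n 2 n by rewrite (subset_trans sX) ?itvS //; lia.
rewrite -(@hit_with_itv2 X) ?(setIidPl sX) //; last by lia.
rewrite -hit_AHM; last by lia.
have [r_gt0 tn] : 1 <= r /\ 1 <= t <= n by lia.
have := hit_with1_itv2 r_gt0 tn sXn.
have /eqP-> : X :\: itv n 2 t == set0 by rewrite setD_eq0.
by rewrite cards0 subn0; lia.
Qed.

(* The sets X for which AHM_3 beats the star. *)
Definition near23 X : bool :=
  (X :&: itv n 2 3 != set0) && (#|X :\: itv n 2 3| <= 1).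

Lemma near23_set1 (x : 'I_n.+1) : 2 <= x <= 3 -> near23 [set x].
Proof.
move=> x23; rewrite /near23 (@setI_neq0 _ _ _ x) ?inE //=.
by rewrite (leq_trans (subset_leq_card (subsetDl _ _))) ?cards1.
Qed.

Lemma hit_AHM3_near23 X : 3 <= r < n -> X \subset itv n 2 n -> near23 X ->
  hit X (AHM n r 3) = hit X (star n r) + gain n r (3 + #|X :\: itv n 2 3|).
Proof.
move=> rn sX /andP[X23 cY]; have t3 : 2 <= 3 <= n by lia.
have := @hit_AHM X 3 t3; rewrite hit_with_itv2 //; try lia.
have [r_gt0 leq3n] : 1 <= r /\ 1 <= 3 <= n by lia.
have := hit_with1_itv2 r_gt0 leq3n sX.
have [c1|c0] : #|X :\: itv n 2 3| = 1 \/ #|X :\: itv n 2 3| = 0 by lia.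
  rewrite c1 /gain -subnDA !addn1 !subSS.
  by rewrite (@binS_sub n r 3 1) ?(@binS_sub n r 3 2); lia.
by rewrite c0 subn0 addn0; lia.
Qed.

Section Far23.

Hypotheses (r_gt2 : 3 <= r) (rn : 4 * r <= n).

Let r_gt0 : 1 <= r. Proof. by lia. Qed.
Let r_ltn : r < n. Proof. by lia. Qed.
Let leq3n : 1 <= 3 <= n. Proof. by lia. Qed.
Let leq3rS : 1 <= 3 <= r.+1. Proof. by lia. Qed.

Let dominated : 3 * 'C(n - 4, r - 3) < 'C(n - 3, r - 2).
Proof.
by have := @bin_pred_dominated 3 (n - 3) (r - 2); rewrite -!subnS; apply; lia.
Qed.

Lemma hit_AHM3_two_outside X : X \subset itv n 2 n ->
  1 < #|X :\: itv n 2 3| -> hit X (AHM n r 3) < hit X (star n r).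
Proof.
move=> sX cY; have := hit_with_without X (itv n 2 3) [set inord 1].
have := hit_AHM X (_ : 2 <= 3 <= n); have := hit_with1_itv2 r_gt0 leq3n sX.
rewrite card_with_itv2 // /gain subSS.
have drop : 'C(n - 3, r - 2) <= 'C(n - 5, r - 2) + 2 * 'C(n - 4, r - 3).
  have := @leq_bin_sub (n - 3) (r - 2) 2; rewrite -subnDA -!subnS; apply.
  by lia.
have : 'C(n - 3 - #|X :\: itv n 2 3|, r - 1) <= 'C(n - 5, r - 1).
  by apply: leq_bin2l; lia.
have := @binS_sub n r 3 1; have := @binS_sub n r 4 1; have := @binS_sub n r 3 2.
by have := dominated; lia.
Qed.

Lemma hit_AHM3_singleton_outside X : X \subset itv n 2 n ->
  #|X| = 1 -> X :&: itv n 2 3 = set0 -> hit X (AHM n r 3) < hit X (star n r).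
Proof.
move=> sX cX X23; have := hit_with_itv2_disjoint leq3rS r_ltn sX X23.
have := hit_AHM X (_ : 2 <= 3 <= n); have := hit_with1_itv2 r_gt0 leq3n sX.
have -> : X :\: itv n 2 3 = X by apply/setDidPl; rewrite -setI_eq0 X23.
rewrite /gain cX -!subnDA !addn1 !subSS.
have := @binS_sub n r 3 1; have := @binS_sub n r 3 2.
by have := dominated; lia.
Qed.

Lemma hit_AHM3_far23 X : X != set0 ->
  X \subset itv n 2 n -> ~~ near23 X -> hit X (AHM n r 3) < hit X (star n r).
Proof.
move=> X0 sX; rewrite negb_and -ltnNge negbK.
have [cY _|cY] := ltnP 1 #|X :\: itv n 2 3|; first exact: hit_AHM3_two_outside.
rewrite orbF => /eqP X23; apply: hit_AHM3_singleton_outside => //.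
have eY : X :\: itv n 2 3 = X by apply/setDidPl; rewrite -setI_eq0 X23.
by apply/eqP; rewrite eqn_leq -{1}eY cY card_gt0.
Qed.

End Far23.

End Hit.

(** * Families other than the star on a large ground set *)

(* The two summands are the error coefficients of hit_upper and
   hit_star_lower. *)
Definition threshold (r : nat) : nat := ('C(4 * r, 3) + (2 * r).+1 ^ 2).+1 * r.

Lemma leq_threshold r n : 3 <= r -> threshold r <= n -> 50 * r <= n.
Proof. by move=> r_gt2; apply: leq_trans; rewrite leq_mul2r; nia. Qed.

Section LargeGround.

Variables n r : nat.
Hypotheses (r_gt2 : 3 <= r) (rn : threshold r <= n).
Implicit Types (X Y : {set 'I_n.+1}) (F G : {set {set 'I_n.+1}}).

Let leq_50rn : 50 * r <= n := leq_threshold r_gt2 rn.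
Let r_gt0 : 1 <= r. Proof. by lia. Qed.
Let r_gt1 : 2 <= r. Proof. by lia. Qed.
Let r_sub2_gt0 : 0 < r - 2. Proof. by lia. Qed.
Let n_gt0 : 1 <= n. Proof. by lia. Qed.
Let n_gt1 : 2 <= n. Proof. by lia. Qed.
Let rS_ltn : r.+1 < n. Proof. by lia. Qed.
Let leq_2rn : 2 * r <= n. Proof. by lia. Qed.
Let leq_3rn : 3 * r <= n. Proof. by lia. Qed.

Lemma hit_star_lower X k :
  X \subset itv n 2 n -> k <= #|X| -> k <= (2 * r).+1 ->
  k * 'C(n - 2, r - 2) <= hit X (star n r) + (2 * r).+1 ^ 2 * 'C(n - 3, r - 3).
Proof.
move=> sX kX kr; have := bin_bonferroni (n - 2) k r_sub2_gt0.
rewrite -!subnS !subnSK // -(hit_star r_gt0 n_gt0 sX).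
have : 'C(n - 1 - #|X|, r - 1) <= 'C(n - 1 - k, r - 1) by apply: leq_bin2l; lia.
have : k * k * 'C(n - 3, r - 3) <= (2 * r).+1 ^ 2 * 'C(n - 3, r - 3).
  by rewrite leq_mul2r -mulnn leq_mul ?orbT.
by lia.
Qed.

Section Nonstar.

Variable F : {set {set 'I_n.+1}}.
Hypotheses (MF : MLCIF r F) (nonstar : F <> star n r).
Hypothesis nonAHM3 : F <> AHM n r 3.

Lemma hitting_sub_pairs Y : Y \subset itv n 2 n ->
  hitting Y F \subset
    (\bigcup_(y in [set y in Y | full_upto r F y])
       with_without r [set inord 1; y] set0)
    :|: [set A in uniform n r | 2 < #|A :&: (Y :|: itv n 1 (2 * r))|].
Proof.
move=> sY; set W := Y :|: _; apply/subsetP => A.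
rewrite in_hitting => /andP[FA /set0Pn[y /setIP[yA yY]]].
have uA := LCIF_uniform (MLCIF_LCIF MF) FA; rewrite in_setU in_set uA /= orbC.
have [//|cW] := ltnP 2 #|A :&: W|; rewrite /=.
have sAW : A :&: itv n 1 (2 * r) \subset A :&: W by rewrite setIS ?subsetUr.
have cA : card_upto A (2 * r) <= 2 := leq_trans (subset_leq_card sAW) cW.
have A1 : inord 1 \in A.
  by apply/negPn/negP => A1; apply: nonAHM3; apply: pair_trace_AHM3 A1 cA.
have [yr|ry] := leqP y (2 * r).
  apply/bigcupP; exists y.
    by rewrite inE yY (pair_trace_full_upto r_gt2 leq_3rn MF FA).
  by rewrite in_with_without uA subUset !sub1set A1 yA disjoint_set0.
have := nonstar_card_upto r_gt2 leq_3rn MF nonstar FA.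
rewrite ltnNge => /negP[]; rewrite -ltnS; apply: leq_trans cW.
apply/proper_card/properP; split=> //.
by exists y; rewrite !inE yA ?yY //= [y <= _]leqNgt ry andbF.
Qed.

Lemma hit_upper Y : Y \subset itv n 2 n -> #|Y| <= 2 * r ->
  hit Y F <= #|[set y in Y | full_upto r F y]| * 'C(n - 2, r - 2)
             + 'C(4 * r, 3) * 'C(n - 3, r - 3).
Proof.
move=> sY cY; apply: leq_trans (subset_leq_card (hitting_sub_pairs sY)) _.
apply: leq_trans (leq_card_setU _ _) (leq_add _ _).
  apply: leq_card_bigcup => y; rewrite inE => /andP[/(subsetP sY)].
  by rewrite inE => /andP[y2 _] _; rewrite card_with_pair.
apply: leq_trans (leq_card_meet r_gt2 _) _.
  by rewrite subUset (subset_trans sY) !itvS.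
rewrite leq_mul2r leq_bin2l ?orbT //.
by apply: leq_trans (leq_card_setU _ _) _; rewrite card_itv //; lia.
Qed.

Lemma few_full_hit_lt Y k h : Y \subset itv n 2 n -> #|Y| <= 2 * r ->
  #|[set y in Y | full_upto r F y]| < k ->
  k * 'C(n - 2, r - 2) <= h + (2 * r).+1 ^ 2 * 'C(n - 3, r - 3) ->
  hit Y F < h.
Proof.
move=> sY cY jk low; apply: leq_ltn_trans (hit_upper sY cY) _.
have := leq_mul jk (leqnn 'C(n - 2, r - 2)); rewrite mulSn => lead.
set c := 'C(4 * r, 3) + (2 * r).+1 ^ 2.
have : c * 'C(n - 3, r - 3) < 'C(n - 2, r - 2).
  have := @bin_pred_dominated c (n - 2) _ r_sub2_gt0; rewrite -!subnS; apply.
  by move: rn; rewrite /threshold -/c; nia.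
by rewrite mulnDl; move: low lead; clear; lia.
Qed.

Lemma hit_leq_window X : hit X F <= hit (itv n 2 (2 * r)) F.
Proof.
apply: (@subset_leq_card _ (hitting X F) (hitting (itv n 2 (2 * r)) F)).
apply/subsetP => A; rewrite !in_hitting => /andP[FA _]; rewrite FA /=.
have := nonstar_card_upto r_gt2 leq_3rn MF nonstar FA.
rewrite -card_gt0 card_upto_cons //; last by lia.
by case: (inord 1 \in A); rewrite ?add0n //; apply: ltnW.
Qed.

Lemma hit_lt_star_or_full X : X \subset itv n 2 n ->
  hit X F < hit X (star n r) \/ {in X, forall x : 'I_n.+1, full_upto r F x}.
Proof.
move=> sX; have [rX|Xr] := ltnP (2 * r) #|X|.
  left; apply: leq_ltn_trans (hit_leq_window X) _.
  have cY : #|itv n 2 (2 * r)| <= 2 * r by rewrite card_itv // subn2; lia.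
  apply: few_full_hit_lt (hit_star_lower sX rX (leqnn _)) => //.
    by rewrite itvS.
  by rewrite ltnS (leq_trans _ cY) // setIdE subset_leq_card ?subsetIl.
have [/forall_inP|] := boolP [forall x in X, full_upto r F x]; first by right.
move=> /forall_inPn[x xX nx].
left; apply: few_full_hit_lt (hit_star_lower sX (leqnn _) (leqW Xr)) => //.
apply/proper_card/properP; split; first by rewrite setIdE subsetIl.
by exists x => //; rewrite inE xX.
Qed.

Lemma hit_singleton2_lt : hit [set inord 2] F < hit [set inord 2] (AHM n r 3).
Proof.
set X : {set 'I_n.+1} := [set inord 2]; have cX : #|X| = 1 by rewrite cards1.
have sX k : 2 <= k -> X \subset itv n 2 k.
  by move=> k2; rewrite sub1set inord_itv ?leqnn.
apply: (few_full_hit_lt (k := 2) (sX n n_gt1)); first by rewrite cX; lia.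
  by rewrite ltnS -cX setIdE subset_leq_card ?subsetIl.
rewrite hit_AHM_sub ?sX -?card_gt0 ?cX //; try lia.
have := hit_star r_gt0 n_gt0 (sX n n_gt1); have := binS_sub n_gt1 r_gt1.
have := @leq_bin_sub (n - 2) (r - 2) 1 r_sub2_gt0.
rewrite /gain cX -!subnDA -!subnS !addn1 subSS mul1n mul2n -addnn.
have : 'C(n - 3, r - 3) <= (2 * r).+1 ^ 2 * 'C(n - 3, r - 3).
  by rewrite leq_pmull // expn_gt0.
by lia.
Qed.

End Nonstar.

(** * The optimal families *)

Definition candidates X : seq {set {set 'I_n.+1}} :=
  let m := \max_(i in X) i in
  [:: star n r, AHM n r 3 & nseq (3 <= m <= r.+1) (AHM n r m)].

Lemma candidatesP X F :
  reflect [\/ F = star n r, F = AHM n r 3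
            | 3 <= \max_(i in X) i <= r.+1 /\ F = AHM n r (\max_(i in X) i)]
          (F \in candidates X).
Proof.
rewrite !inE mem_nseq lt0b; apply: (iffP or3P) => -[].
- by move/eqP; constructor 1.
- by move/eqP; constructor 2.
- by move=> /andP[? /eqP]; constructor 3.
- by move/eqP; constructor 1.
- by move/eqP; constructor 2.
- by move=> [mr /eqP eF]; constructor 3; rewrite mr.
Qed.

Lemma MLCIF_candidates X F : F \in candidates X -> MLCIF r F.
Proof.
by case/candidatesP => [->|->|[mr ->]]; [apply: star_MLCIF|apply: AHM_MLCIF..].
Qed.

Lemma hit_candidates X F : X != set0 -> X \subset itv n 2 n -> MLCIF r F ->
  F \notin candidates X -> exists2 G, G \in candidates X & hit X F < hit X G.
Proof.
move=> X0 sX MF /candidatesP nF; have X_gt0 : 0 < #|X| by rewrite card_gt0.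
have nonstar : F <> star n r by move=> eF; apply: nF; constructor 1.
have nonAHM3 : F <> AHM n r 3 by move=> eF; apply: nF; constructor 2.
have starX : star n r \in candidates X by apply/candidatesP; constructor 1.
have AHM3X : AHM n r 3 \in candidates X by apply/candidatesP; constructor 2.
have [m3|/(bigmax_lt3 n_gt1 X0 sX) eX] := leqP 3 (\max_(i in X) i).
  have [ltF|fullX] := hit_lt_star_or_full MF nonstar nonAHM3 sX.
    by exists (star n r).
  have [x xX em] := eq_bigmax_cond (@nat_of_ord _) X_gt0.
  have fm := fullX x xX; rewrite -em in fm.
  have mr : 3 <= \max_(i in X) i <= r.+1.
    by rewrite m3 (nonstar_full_upto_leq r_gt2 leq_3rn MF) // em -ltnS ltn_ord.
  exists (AHM n r (\max_(i in X) i)).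
    by apply/candidatesP; constructor 3.
  have sXm := sub_itv2_bigmax sX.
  have [eF|//] := full_upto_hit MF r_gt1 leq_2rn mr X0 sXm fm.
  by case: nF; constructor 3.
by exists (AHM n r 3) => //; rewrite eX; apply: hit_singleton2_lt.
Qed.

Lemma optimal_candidates X F : X != set0 -> X \subset itv n 2 n ->
  optimal r X F <->
  F \in candidates X /\ {in candidates X, forall G, hit X G <= hit X F}.
Proof.
move=> X0 sX; split=> [[MF optF]|[FX maxF]].
  split=> [|G /MLCIF_candidates/optF//]; apply/negPn/negP => nF.
  have [G GX] := hit_candidates X0 sX MF nF.
  by rewrite ltnNge optF //; apply: MLCIF_candidates GX.
split=> [|G MG]; first exact: MLCIF_candidates FX.
have [/maxF//|nG] := boolP (G \in candidates X).
have [G' G'X ltG] := hit_candidates X0 sX MG nG.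
exact: leq_trans (ltnW ltG) (maxF G' G'X).
Qed.

Lemma bigmax_eq4_near23 X : X != set0 -> near23 X ->
  (\max_(i in X) i == 4) = (inord 4 \in X).
Proof.
rewrite -card_gt0 => X_gt0 /andP[_ cY]; have n_gt3 : 4 <= n by lia.
have [x xX em] := eq_bigmax_cond (@nat_of_ord _) X_gt0.
rewrite em; apply/eqP/idP => [<-|X4].
  by rewrite inord_val.
have x4 : 4 <= x by rewrite -em -[4](@inordK n 4) //; apply: leq_bigmax_cond.
apply/eqP; rewrite -eq_inord //; apply: contraLR cY => x_neq4.
rewrite -ltnNge; apply/card_gt1P; exists x, (inord 4).
by rewrite !in_setD xX X4 !inE inordK //; split=> //; lia.
Qed.

Lemma near23_leqif_bigmax X : X != set0 -> X \subset itv n 2 n -> near23 X ->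
  3 <= \max_(i in X) i ->
  3 + #|X :\: itv n 2 3| <= \max_(i in X) i ?= iff (\max_(i in X) i <= 4).
Proof.
move=> X0 sX nX; set m := \max_(i in X) i; set Y := X :\: _ => m3.
have [_ cY] := andP nX; have [Y0|/card_gt0P[y]] := posnP #|Y|.
  have m_neq4 : m != 4.
    rewrite bigmax_eq4_near23 //; apply/negP => X4.
    by have := card0_eq Y0 (inord 4); rewrite inE X4 inord_itv //; lia.
  by rewrite Y0; split=> //; rewrite eqn_leq m3; lia.
move=> yY; have [yX y23] := setDP yY.
have cY1 : #|Y| = 1 by apply/eqP; rewrite eqn_leq cY; apply/card_gt0P; exists y.
have ym : y <= m by apply: leq_bigmax_cond.
have m4 : 4 <= m by have := subsetP sX y yX; move: y23 ym; rewrite !inE; lia.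
by rewrite cY1; split=> //; rewrite eqn_leq m4.
Qed.

Lemma hit_AHM_leqif_near23 X (m := \max_(i in X) i) :
  X != set0 -> X \subset itv n 2 n -> near23 X -> 3 <= m <= r.+1 ->
  hit X (AHM n r m) <= hit X (AHM n r 3) ?= iff (m <= 4).
Proof.
move=> X0 sX nX /andP[m3 mr]; have [_ cY] := andP nX.
have [t_leq_m t_eq_m] := near23_leqif_bigmax X0 sX nX m3.
have r_gt2_ltn : 3 <= r < n by lia.
rewrite hit_AHM3_near23 // hit_AHM_sub ?sub_itv2_bigmax //; try lia.
have tr : 3 + #|X :\: itv n 2 3| <= r.+1 by lia.
split; first by rewrite leq_add2l gain_leq.
by rewrite eqn_add2l eqn_leq !gain_leq // -eqn_leq.
Qed.

Lemma optimal_near23 X F : X != set0 -> X \subset itv n 2 n -> near23 X ->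
  optimal r X F <-> F = AHM n r 3 \/ inord 4 \in X /\ F = AHM n r 4.
Proof.
move=> X0 sX nX; set m := \max_(i in X) i.
have AHM_leqif := hit_AHM_leqif_near23 X0 sX nX; rewrite -/m in AHM_leqif.
have lt_star : hit X (star n r) < hit X (AHM n r 3).
  rewrite hit_AHM3_near23 //; last by lia.
  by rewrite -[ltnLHS]addn0 ltn_add2l gain_gt0 //; lia.
have AHM3_best : {in candidates X, forall G, hit X G <= hit X (AHM n r 3)}.
  by move=> G /candidatesP[->|->|[/AHM_leqif[+ _] ->]] //; apply: ltnW.
have AHM3X : AHM n r 3 \in candidates X by apply/candidatesP; constructor 2.
rewrite optimal_candidates //; split=> [[/candidatesP FX maxF]|[->//|[X4 ->]]].
  have := maxF _ AHM3X; case: FX => [->|->|[mr ->]]; [|by left|].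
    by rewrite leqNgt lt_star.
  rewrite -/m in mr *; rewrite (geq_leqif (AHM_leqif mr)) => m_leq4.
  have [m4|m_neq4] := eqVneq m 4; last by left; congr AHM; lia.
  by right; rewrite -bigmax_eq4_near23 // -/m m4.
have /eqP m4 : m == 4 by rewrite bigmax_eq4_near23.
have mr : 3 <= m <= r.+1 by rewrite m4; lia.
split; first by apply/candidatesP; constructor 3; rewrite -/m m4 in mr *.
move=> G /AHM3_best/leq_trans->//.
by rewrite -m4 (geq_leqif (AHM_leqif mr)) m4.
Qed.

Lemma optimal_far23 X F : X != set0 -> X \subset itv n 2 n -> ~~ near23 X ->
  optimal r X F <->
  F = if X \subset itv n 2 r.+1 then AHM n r (\max_(i in X) i) else star n r.
Proof.
move=> X0 sX fX; rewrite -bigmax_leq_itv2 //; set m := \max_(i in X) i.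
have lt_AHM3 : hit X (AHM n r 3) < hit X (star n r).
  by apply: hit_AHM3_far23 => //; lia.
have m3 : 3 <= m.
  rewrite leqNgt; apply: contra fX => /(bigmax_lt3 n_gt1 X0 sX) ->.
  by rewrite near23_set1 ?inordK //; lia.
have starX : star n r \in candidates X by apply/candidatesP; constructor 1.
rewrite optimal_candidates //; have [mr|rm] := leqP m r.+1.
  have lt_star : hit X (star n r) < hit X (AHM n r m).
    rewrite hit_AHM_sub ?sub_itv2_bigmax //; try lia.
    by rewrite -[ltnLHS]addn0 ltn_add2l gain_gt0 //; lia.
  have AHMX : AHM n r m \in candidates X.
    by apply/candidatesP; constructor 3; rewrite m3.
  split=> [[/candidatesP[->|->|[_ ->]//] maxF]|->].
  - by have := maxF _ AHMX; rewrite leqNgt lt_star.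
  - by have := maxF _ AHMX; rewrite leqNgt (ltn_trans lt_AHM3).
  split=> // G /candidatesP[->|->|[_ ->]] //; apply: ltnW => //.
  exact: ltn_trans lt_star.
split=> [[/candidatesP[//|->|[]] maxF]|->].
- by have := maxF _ starX; rewrite leqNgt lt_AHM3.
- by rewrite -/m; lia.
split=> // G /candidatesP[->|->|[]] //; first exact: ltnW.
by rewrite -/m; lia.
Qed.

End LargeGround.

(** * The four cases of the theorem *)

Section Cases.

Variable n : nat.
Hypothesis n_gt3 : 4 <= n.
Implicit Type X : {set 'I_n.+1}.

Let n_gt2 : 3 <= n. Proof. by lia. Qed.
Let card_itv23 : #|itv n 2 3| = 2. Proof. by rewrite card_itv. Qed.

Lemma case_a_near23 X : case_a X -> near23 X.
Proof. by move->; rewrite near23_set1 ?inordK //; lia. Qed.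

Lemma case_b_near23 X : case_b X -> near23 X.
Proof.
rewrite /case_b /near23 -itv23 // => -[cX X23]; rewrite X23 /=.
have := cardsID (itv n 2 3) X; move: X23; rewrite cX -card_gt0.
by move: #|_ :&: _| #|_ :\: _|; lia.
Qed.

Lemma case_c_near23 X : case_c X -> near23 X.
Proof.
rewrite /case_c /near23 -itv23 // => -[cX sX].
have := cardsID (itv n 2 3) X.
by rewrite -card_gt0 (setIidPr sX) cX card_itv23; move: #|_ :\: _|; lia.
Qed.

Lemma near23_cases X : near23 X ->
  [\/ case_a X, case_b X, case_c X | X = [set inord 3]].
Proof.
case/andP=> X23 cY; have cX := cardsID (itv n 2 3) X.
have cI : #|X :&: itv n 2 3| <= 2.
  by rewrite (leq_trans (subset_leq_card (subsetIr _ _))) ?card_itv23.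
have I_gt0 : 0 < #|X :&: itv n 2 3| by rewrite card_gt0.
have [cX1|[cX2|[cX3 cI2]]] :
    #|X| = 1 \/ #|X| = 2 \/ #|X| = 3 /\ #|X :&: itv n 2 3| = 2.
  by rewrite -cX; move: I_gt0 cI cY; move: #|_ :&: _| #|_ :\: _|; lia.
- have /cards1P[x eX] : #|X| == 1 by rewrite cX1.
  have [y] := set0Pn _ X23; rewrite eX !inE => /andP[/eqP-> x23].
  have [x2|x2] := eqVneq x (inord 2); first by constructor 1; rewrite x2.
  constructor 4; congr [set _]; apply/eqP.
  by move: x2; rewrite !eq_inord //; lia.
- by constructor 2; split=> //; rewrite -itv23.
constructor 3; split=> //; rewrite -itv23 //.
by apply/setIidPr/eqP; rewrite eqEcard subsetIr card_itv23 cI2.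
Qed.

Lemma mem4_set1 k : k <= n -> (inord 4 \in [set inord k : 'I_n.+1]) = (4 == k).
Proof. by move=> kn; rewrite inE eq_inord // inordK. Qed.

Lemma case_c_mem4 X : case_c X ->
  inord 4 \in X <-> X = [set inord 2; inord 3; inord 4].
Proof.
rewrite /case_c -itv23 // => -[cX sX].
split=> [X4|->]; last by rewrite !inE eqxx orbT.
apply/esym/eqP; rewrite eqEcard cX subUset sX sub1set X4 /=.
by rewrite setUC cardsU1 card_itv23 inE inordK.
Qed.

End Cases.

Theorem theorem1p5 (r : nat) (hr : 3 <= r) :
  exists n0 : nat, forall n : nat, n0 <= n ->
  forall X : {set 'I_n.+1}, X != set0 -> X \subset itv n 2 n ->
  [/\ case_a X ->
        forall F, optimal r X F <-> F = AHM n r 3,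
      case_b X ->
        forall F, optimal r X F <->
          F = AHM n r 3 \/ (inord 4 \in X /\ F = AHM n r 4),
      case_c X ->
        forall F, optimal r X F <->
          F = AHM n r 3 \/
          (X = [set inord 2; inord 3; inord 4] /\ F = AHM n r 4),
      case_d r X ->
        forall F, optimal r X F <-> F = AHM n r (\max_(i in X) i)
    & ~ (case_a X \/ case_b X \/ case_c X \/ case_d r X) ->
        forall F, optimal r X F <-> F = star n r].
Proof.
exists (threshold r) => n rn X X0 sX.
have [n_gt2 n_gt3] : 3 <= n /\ 4 <= n by have := leq_threshold hr rn; lia.
have near := optimal_near23 hr rn _ X0 sX.
have far := optimal_far23 hr rn _ X0 sX.
split.
- move=> aX F; rewrite near ?case_a_near23 // aX mem4_set1 ?(ltnW n_gt2) //.
  by split=> [[|[]]//|]; left.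
- by move=> bX F; apply: near; apply: case_b_near23.
- by move=> cX F; rewrite near ?case_c_near23 // case_c_mem4.
- case=> sXr na nb nc F.
  have [nX|fX] := boolP (near23 X); last by rewrite far ?sXr.
  have [//|//|//|X3] := near23_cases n_gt3 nX.
  rewrite near // X3 mem4_set1 // big_set1 inordK //.
  by split=> [[|[]]//|]; left.
- move=> none F.
  have nXr : ~~ (X \subset itv n 2 r.+1).
    by apply/negP => sXr; apply: (none); do 3 right; split=> //; tauto.
  rewrite far ?(negPf nXr) //.
  apply/negP => /(near23_cases n_gt3)[|||X3]; [tauto..|].
  by move: nXr; rewrite X3 sub1set inord_itv //; lia.
Qed.
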